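(* Let $n\ge 2$ be an integer. The Clifford algebra $\mathbb{R}_n$ endowed with the Clifford conjugation satisfies: (i) $\mathcal{R}(\mathbb{R}_2)=\mathcal{R}(\mathbb{H})=1$, where $\mathbb{H}$ is the division algebra of quaternions with the standard conjugation; (ii) $\mathcal{R}(\mathbb{R}_3)=\mathcal{R}(\mathbb{R}_4)=2$; (iii) if $n\equiv 1\bmod 4$, then $\mathcal{R}(\mathbb{R}_n)=2$; (iv) if $n\ge 6$ and $n\equiv 0,2,3\bmod 4$, then $3\le\mathcal{R}(\mathbb{R}_n)\le 4$. Here $\mathcal{R}$ denotes the reconstructing number.
   Context: **Clifford algebras.** $\mathbb{R}_n:=\mathbb{R}_{0,n}$ is the associative real algebra of dimension $2^n$ with basis $\{e_K\}_{K\in\mathcal{P}(n)}$ ($\mathcal{P}(n)$ is the power set of $\{1,\dots,n\}$), where $e_\varnothing=1$, $e_K=e_{k_1}\cdots e_{k_s}$ for $K=\{k_1<\dots<k_s\}$ (with $e_k:=e_{\{k\}}$), $e_k^2=-1$ for all $k$, and $e_ke_h=-e_he_k$ for $k\ne h$. The Clifford conjugation is the real linear involution $x\mapsto x^c$ with $e_K^c=e_K$ if $|K|\equiv 0,3\bmod 4$ and $e_K^c=-e_K$ if $|K|\equiv 1,2\bmod 4$. The quaternions $\mathbb{H}$ are equipped with the basis $e_\varnothing=1,\ e_{\{1\}}=j,\ e_{\{2\}}=i,\ e_{\{1,2\}}=ji$; $\mathbb{R}_2$ is $*$-isomorphic to $\mathbb{H}$ with the standard conjugation. Let $A$ be one of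 these algebras, with its involution $x\mapsto x^c$, and $\mathbb{S}_A:=\{J\in A:J^c=-J,\ J^2=-1\}$. **Slice regular functions.** For $J\in\mathbb{S}_A$ let $\mathbb{C}_J:=\{\alpha+\beta J:\alpha,\beta\in\mathbb{R}\}$, and let $Q_A:=\bigcup_{J\in\mathbb{S}_A}\mathbb{C}_J$. For $D\subset\mathbb{C}$ non-empty, open and invariant under complex conjugation, let $\Omega_D:=\{\alpha+\beta J:\alpha,\beta\in\mathbb{R},\ \alpha+i\beta\in D,\ J\in\mathbb{S}_A\}\subset Q_A$ (an open circular set). It is a circular slice domain if moreover $D$ is connected and $D\cap\mathbb{R}\ne\varnothing$. A stem function on $D$ is $F=F_1+\iota F_2:D\to A\otimes_{\mathbb{R}}\mathbb{C}$ ($\iota$ the imaginary unit of the second factor, $F_1,F_2:D\to A$) with $F_1(\bar z)=F_1(z)$, $F_2(\bar z)=-F_2(z)$. It induces the slice function $f=\mathcal{I}(F):\Omega_D\to A$, $f(\alpha+\beta J)=F_1(\alpha+i\beta)+JF_2(\alpha+i\beta)$. $f$ is slice regular if $F$ is of class $C^1$ and $\frac{\partial F}{\partial\alpha}+\iota\frac{\partial F}{\partial\beta}=0$. The real components of $f$ are the functions $f_K:\Omega_D\to\mathbb{R}$ with $f=\sum_K f_Ke_K$. **Reconstructing number.** $\mathcal{R}(A)$ is the minimum integer $\ell$ for which there is a subset $\mathcal{K}\subset\mathcal{P}(n)$ of cardinality $\ell$ such that, for each circular slice domain $\Omega\subset Q_A$ and each slice regular $f:\Omega\to A$, if $f_K$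 is constant for each $K\in\mathcal{K}$, then $f$ is constant. *)

(* Defs.v *)
From HB Require Import structures.
From mathcomp Require Import all_boot all_order all_algebra.
From mathcomp Require Import all_classical all_reals all_analysis.
From mathcomp Require Import ring.

Set Implicit Arguments.
Unset Strict Implicit.
Unset Printing Implicit Defensive.

Import Order.TTheory GRing.Theory Num.Theory.
Import numFieldNormedType.Exports.

Local Open Scope ring_scope.

(* An algebra with a conjugation and a basis indexed by the subsets of
   {1, ..., n}, encoded as {0, ..., n.-1};
   x = \sum_K scoord K x *: sbasis K is the decomposition of x on the basis. *)
Record starAlg (R : realType) (n : nat) := StarAlg {
  salg :> algType R;
  sconj : salg -> salg;
  sbasis : {set 'I_n} -> salg;
  scoord : {set 'I_n} -> salg -> R;
  scoordP : forall (x : salg) (c : {set 'I_n} -> R),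
    x = \sum_K c K *: sbasis K <-> forall K, c K = scoord K x }.

(* x : cliff R n stands for \sum_K x K *: e_K. *)
Definition cliff (R : realType) (n : nat) : Type := {ffun {set 'I_n} -> R^o}.

Section CliffordAlgebra.
Context {R : realType} {n : nat}.
Local Notation T := (cliff R n).
Implicit Types (K H L : {set 'I_n}) (x y z : T).

HB.instance Definition _ := GRing.Lmodule.copy T {ffun {set 'I_n} -> R^o}.

Definition symdiff K H : {set 'I_n} :=
  [set k | (k \in K) (+) (k \in H)]%SET.

(* e_K * e_H = csign K H *: e_(symdiff K H): sorting the product costs one sign
   for each pair (k, h) in K x H with h < k, and then each common index costs
   one more, as e_k ^+ 2 = -1. *)
Definition csign K H : R :=
  (-1) ^+ #|[pred p : 'I_n * 'I_n | [&& p.1 \in K, p.2 \in H & p.2 <= p.1]%N]|.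

Definition cliff_basis K : T := [ffun L => (L == K)%:R].
Definition cliff_one : T := cliff_basis finset.set0.
Definition cliff_mul x y : T :=
  [ffun L => \sum_K \sum_(H | symdiff K H == L) csign K H * x K * y H].

Definition cliff_conj x : T :=
  [ffun K : {set 'I_n} =>
     if (#|K| %% 4)%N \in [:: 0%N; 3%N] then x K else - x K].

Lemma symdiffK K : cancel (symdiff K) (symdiff K).
Proof. by move=> H; apply/setP => k; rewrite !inE addKb. Qed.

Lemma symdiff0 K : symdiff finset.set0 K = K.
Proof. by apply/setP => k; rewrite !inE. Qed.

Lemma symdiffA K H L : symdiff K (symdiff H L) = symdiff (symdiff K H) L.
Proof. by apply/setP => k; rewrite !inE addbA. Qed.

Lemma cliff_mulE x y L :
  cliff_mul x y L =
  \sum_K csign K (symdiff K L) * x K * y (symdiff K L).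
Proof.
rewrite ffunE; apply: eq_bigr => K _; rewrite (big_pred1 (symdiff K L)) // => H.
by apply/eqP/eqP => [<-|->]; rewrite symdiffK.
Qed.

Lemma csignE K H : csign K H =
  \prod_(p : 'I_n * 'I_n)
    (if [&& p.1 \in K, p.2 \in H & p.2 <= p.1]%N then -1 else 1).
Proof. by rewrite -big_mkcond prodr_const. Qed.

Lemma csignDl K H L : csign (symdiff K H) L = csign K L * csign H L.
Proof.
rewrite !csignE -[RHS]big_split; apply: eq_bigr => -[k h] _ /=; rewrite !inE.
case: (_ && (h <= k)%N); rewrite ?andbF ?andbT;
  by case: (k \in K); case: (k \in H); rewrite /= ?mulrNN ?mulr1 ?mul1r.
Qed.

Lemma csignDr K H L : csign L (symdiff K H) = csign L K * csign L H.
Proof.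
rewrite !csignE -[RHS]big_split; apply: eq_bigr => -[k h] _ /=; rewrite !inE.
case: (k \in L) (h <= k)%N => [] [] /=; rewrite ?andbF ?andbT ?mulr1 //;
  by case: (h \in K); case: (h \in H); rewrite /= ?mulrNN ?mulr1 ?mul1r.
Qed.

Lemma csign_sqr K H : csign K H * csign K H = 1.
Proof. by rewrite -expr2 sqrr_sign. Qed.

Lemma csign0l K : csign finset.set0 K = 1.
Proof. by rewrite csignE big1 // => p _; rewrite inE. Qed.

Lemma csign0r K : csign K finset.set0 = 1.
Proof. by rewrite csignE big1 // => p _; rewrite inE andbF. Qed.

Lemma cliff_basis_mul K H :
  cliff_mul (cliff_basis K) (cliff_basis H) =
  csign K H *: cliff_basis (symdiff K H).
Proof.
apply/ffunP => L; rewrite cliff_mulE !ffunE (bigD1 K) //= big1 ?addr0.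
  rewrite !ffunE eqxx mulr1 -[in RHS](inj_eq (can_inj (symdiffK K))) symdiffK.
  case: eqP => [->//|_]; by rewrite !mulr0 [RHS]mulr0.
by move=> M /negPf nMK; rewrite !ffunE nMK mulr0 mul0r.
Qed.

Lemma cliff_mulA : associative cliff_mul.
Proof.
move=> x y z; apply/ffunP => L; rewrite !cliff_mulE.
under eq_bigr => K _ do rewrite cliff_mulE mulr_sumr.
under [RHS]eq_bigr => M _ do rewrite cliff_mulE mulr_sumr mulr_suml.
rewrite [RHS]exchange_big /=; apply: eq_bigr => K _.
rewrite (reindex_inj (can_inj (symdiffK K))) /=; apply: eq_bigr => M _.
have -> : symdiff (symdiff K M) (symdiff K L) = symdiff M L.
  apply/setP => k; rewrite !inE.
  by case: (k \in K); case: (k \in M); case: (k \in L).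
rewrite !csignDl !csignDr.
set a := csign K K; set b := csign K L; set c := csign K M.
set d := csign M L; set e := csign M M.
have bb : b * b = 1 by apply: csign_sqr.
have -> : a * b * x K * (c * b * (e * d) * y (symdiff K M) * z (symdiff M L)) =
  (b * b) * (a * c * e * d * x K * y (symdiff K M) * z (symdiff M L)) by ring.
by rewrite bb; ring.
Qed.

Lemma cliff_mul1 : left_id cliff_one cliff_mul.
Proof.
move=> x; apply/ffunP => L; rewrite cliff_mulE (bigD1 finset.set0) //= big1.
  by rewrite symdiff0 csign0l !ffunE eqxx !mul1r addr0.
by move=> M /negPf nM0; rewrite ffunE nM0 mulr0 mul0r.
Qed.

Lemma cliff_mulr1 : right_id cliff_one cliff_mul.
Proof.
move=> x; apply/ffunP => L; rewrite cliff_mulE (bigD1 L) //= big1.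
  have -> : symdiff L L = finset.set0 by apply/setP => k; rewrite !inE addbb.
  by rewrite csign0r !ffunE eqxx mulr1 mul1r addr0.
move=> M nML; rewrite ffunE.
suff /negPf -> : symdiff M L != finset.set0 by rewrite mulr0.
apply: contraNneq nML => ML0; apply/eqP/setP => k.
by move/setP/(_ k): ML0; rewrite !inE; case: (k \in M); case: (k \in L).
Qed.

Lemma cliff_mulDl : left_distributive cliff_mul +%R.
Proof.
move=> x y z; apply/ffunP => L; rewrite [RHS]ffunE !cliff_mulE -big_split /=.
by apply: eq_bigr => K _; rewrite ffunE mulrDr mulrDl.
Qed.

Lemma cliff_mulDr : right_distributive cliff_mul +%R.
Proof.
move=> x y z; apply/ffunP => L; rewrite [RHS]ffunE !cliff_mulE -big_split /=.
by apply: eq_bigr => K _; rewrite ffunE mulrDr.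
Qed.

Lemma cliff_one_neq0 : cliff_one != 0.
Proof.
apply/eqP => /ffunP /(_ finset.set0); rewrite !ffunE eqxx => /eqP.
by rewrite oner_eq0.
Qed.

HB.instance Definition _ := GRing.Zmodule_isNzRing.Build T
  cliff_mulA cliff_mul1 cliff_mulr1 cliff_mulDl cliff_mulDr cliff_one_neq0.

Lemma cliff_scaleAl (a : R) (x y : T) : a *: (x * y) = (a *: x : T) * y.
Proof.
apply/ffunP => L; rewrite [LHS]ffunE [LHS]/GRing.scale /= !cliff_mulE mulr_sumr.
by apply: eq_bigr => K _; rewrite ffunE [(a *: x K)%R]/GRing.scale /=; ring.
Qed.

HB.instance Definition _ := GRing.Lmodule_isLalgebra.Build R T cliff_scaleAl.

Lemma cliff_scaleAr (a : R) (x y : T) : a *: (x * y) = x * (a *: y).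
Proof.
apply/ffunP => L; rewrite [LHS]ffunE [LHS]/GRing.scale /= !cliff_mulE mulr_sumr.
by apply: eq_bigr => K _; rewrite ffunE [(a *: y _)%R]/GRing.scale /=; ring.
Qed.

HB.instance Definition _ := GRing.Lalgebra_isAlgebra.Build R T cliff_scaleAr.

Lemma cliff_coordP (x : T) (c : {set 'I_n} -> R) :
  x = \sum_K c K *: cliff_basis K <-> forall K, c K = x K.
Proof.
have sumE K : (\sum_H c H *: cliff_basis H) K = c K.
  rewrite sum_ffunE (bigD1 K) //= big1 ?addr0.
    by rewrite !ffunE eqxx [LHS]mulr1.
  by move=> H /negPf nHK; rewrite !ffunE eq_sym nHK [LHS]mulr0.
split=> [-> K|cx]; first by rewrite sumE.
by apply/ffunP => K; rewrite sumE cx.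
Qed.

Local Notation e k := (cliff_basis [set k]%SET).

Lemma cliff_basis0 : cliff_basis finset.set0 = 1.
Proof. by []. Qed.

Lemma cliff_gen_sqr k : e k * e k = -1.
Proof.
rewrite [LHS]cliff_basis_mul.
have -> : symdiff [set k]%SET [set k]%SET = finset.set0.
  by apply/setP => h; rewrite !inE addbb.
rewrite /csign (_ : #|_| = 1%N) ?expr1 ?scaleN1r //.
rewrite -(card1 (k, k)); apply: eq_card => -[h l]; rewrite !inE /= xpair_eqE.
by case: eqP => //= ->; case: eqP => //= ->; rewrite leqnn.
Qed.

Lemma cliff_gen_anticomm k h : k != h -> e k * e h = - (e h * e k).
Proof.
suff H (a b : 'I_n) : (a < b)%N -> e a * e b = - (e b * e a).
  move=> /negPf nkh; case: (ltngtP k h) => [/H//|/H ->|/val_inj kh].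
    by rewrite opprK.
  by rewrite kh eqxx in nkh.
move=> ab; rewrite [e a * _]cliff_basis_mul [e b * _]cliff_basis_mul.
have -> : symdiff [set b]%SET [set a]%SET = symdiff [set a]%SET [set b]%SET.
  by apply/setP => l; rewrite !inE addbC.
rewrite -scaleNr; congr (_ *: _); rewrite /csign.
rewrite (_ : #|_| = 0%N); last first.
  apply: eq_card0 => -[l m]; rewrite !inE /=.
  by do 2![case: eqP => //= ->]; rewrite leqNgt ab.
rewrite (_ : #|_| = 1%N) ?expr1 ?opprK //.
rewrite -(card1 (b, a)); apply: eq_card => -[l m]; rewrite !inE /= xpair_eqE.
by case: eqP => //= ->; case: eqP => //= ->; rewrite ltnW.
Qed.

(* The product runs in increasing order of k. *)
Lemma cliff_basisE K : cliff_basis K = \prod_(k in K) e k.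
Proof.
suff H (s : seq 'I_n) : sorted ltn (map val s) ->
    cliff_basis [set k in s]%SET = \prod_(k <- s) e k.
  rewrite -big_filter -H.
    congr cliff_basis; apply/setP => k.
    by rewrite !inE mem_filter mem_index_enum andbT.
  apply: (subseq_sorted ltn_trans (map_subseq _ (filter_subseq _ _))).
  by rewrite [index_enum _]unlock -enumT val_enum_ord iota_ltn_sorted.
elim: s => [_|k s IHs ks].
  by rewrite big_nil; congr cliff_basis; apply/setP => k; rewrite !inE.
rewrite big_cons -IHs; last exact: path_sorted ks.
rewrite [RHS]cliff_basis_mul.
have ltk h : h \in s -> (k < h)%N.
  by move=> hs; apply: (allP (order_path_min ltn_trans ks)); exact: map_f.
rewrite /csign (_ : #|_| = 0%N); last first.
  apply: eq_card0 => -[l m]; rewrite !inE /=.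
  case: eqP => //= ->; case: (boolP (m \in s)) => //= /ltk.
  by rewrite ltnNge => /negPf.
rewrite expr0 scale1r; congr cliff_basis; apply/setP => h; rewrite !inE.
by case: eqP => //= ->; apply/esym/negP => /ltk; rewrite ltnn.
Qed.

End CliffordAlgebra.

Definition cliffAlg (R : realType) (n : nat) : starAlg R n :=
  @StarAlg R n (cliff R n) cliff_conj cliff_basis (fun K x => x K) cliff_coordP.

(* (a, b, c, d) : quat R stands for a + b i + c j + d k. *)
Definition quat (R : realType) : Type := (R^o * R^o * R^o * R^o)%type.

Section Quaternions.
Context {R : realType}.
Local Notation T := (quat R).
Implicit Types x y z : T.

HB.instance Definition _ := GRing.Lmodule.copy T (R^o * R^o * R^o * R^o)%type.

Definition quat_mul x y : T :=
  let: (a1, b1, c1, d1) := x in let: (a2, b2, c2, d2) := y in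
  (a1 * a2 - b1 * b2 - c1 * c2 - d1 * d2,
   a1 * b2 + b1 * a2 + c1 * d2 - d1 * c2,
   a1 * c2 - b1 * d2 + c1 * a2 + d1 * b2,
   a1 * d2 + b1 * c2 - c1 * b2 + d1 * a2).

Definition quat_conj x : T := let: (a, b, c, d) := x in (a, - b, - c, - d).

Definition quat_one : T := (1, 0, 0, 0).
Definition quat_i : T := (0, 1, 0, 0).
Definition quat_j : T := (0, 0, 1, 0).

Lemma quat_mulA : associative quat_mul.
Proof.
move=> [[[a1 b1] c1] d1] [[[a2 b2] c2] d2] [[[a3 b3] c3] d3] /=.
by congr (_, _, _, _); ring.
Qed.

Lemma quat_mul1 : left_id quat_one quat_mul.
Proof. by move=> [[[a b] c] d] /=; congr (_, _, _, _); ring. Qed.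

Lemma quat_mulr1 : right_id quat_one quat_mul.
Proof. by move=> [[[a b] c] d] /=; congr (_, _, _, _); ring. Qed.

Lemma quat_mulDl : left_distributive quat_mul +%R.
Proof.
move=> [[[a1 b1] c1] d1] [[[a2 b2] c2] d2] [[[a3 b3] c3] d3] /=.
by congr (_, _, _, _) => /=; ring.
Qed.

Lemma quat_mulDr : right_distributive quat_mul +%R.
Proof.
move=> [[[a1 b1] c1] d1] [[[a2 b2] c2] d2] [[[a3 b3] c3] d3] /=.
by congr (_, _, _, _) => /=; ring.
Qed.

Lemma quat_one_neq0 : quat_one != 0.
Proof. by apply/eqP => -[/eqP]; rewrite oner_eq0. Qed.

HB.instance Definition _ := GRing.Zmodule_isNzRing.Build T
  quat_mulA quat_mul1 quat_mulr1 quat_mulDl quat_mulDr quat_one_neq0.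

Lemma quat_mulE (a1 b1 c1 d1 a2 b2 c2 d2 : R^o) :
  ((a1, b1, c1, d1) : T) * ((a2, b2, c2, d2) : T) =
  (a1 * a2 - b1 * b2 - c1 * c2 - d1 * d2,
   a1 * b2 + b1 * a2 + c1 * d2 - d1 * c2,
   a1 * c2 - b1 * d2 + c1 * a2 + d1 * b2,
   a1 * d2 + b1 * c2 - c1 * b2 + d1 * a2).
Proof. by []. Qed.

Lemma quat_scaleE (t a b c d : R^o) :
  t *: ((a, b, c, d) : T) = (t * a, t * b, t * c, t * d).
Proof. by []. Qed.

Lemma quat_scaleAl (t : R) x y : t *: (x * y) = (t *: x : T) * y.
Proof.
case: x y => [[[a1 b1] c1] d1] [[[a2 b2] c2] d2].
by rewrite [in RHS]quat_scaleE !quat_mulE quat_scaleE; congr (_, _, _, _); ring.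
Qed.

HB.instance Definition _ := GRing.Lmodule_isLalgebra.Build R T quat_scaleAl.

Lemma quat_scaleAr (t : R) x y : t *: (x * y) = x * (t *: y).
Proof.
case: x y => [[[a1 b1] c1] d1] [[[a2 b2] c2] d2].
by rewrite [in RHS]quat_scaleE !quat_mulE quat_scaleE; congr (_, _, _, _); ring.
Qed.

HB.instance Definition _ := GRing.Lalgebra_isAlgebra.Build R T quat_scaleAr.

(* The basis 1, j, i, j i of the quaternions. The elements 1 and 2 of the index
   set {1, 2} are ord0 and ord_max in 'I_2. *)
Definition quat_basis (K : {set 'I_2}) : T :=
  (if ord0 \in K then quat_j else 1) * (if ord_max \in K then quat_i else 1).

(* The last coordinate is - d because j i = - k. *)
Definition quat_coord (K : {set 'I_2}) (x : T) : R :=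
  let: (a, b, c, d) := x in
  if ord0 \in K then if ord_max \in K then - d else c
  else if ord_max \in K then b else a.

Definition set2_of (p : bool * bool) : {set 'I_2} :=
  [set k : 'I_2 | if k == ord0 then p.1 else p.2]%SET.

Lemma in_set2_of p :
  ((ord0 \in set2_of p) = p.1) * ((ord_max \in set2_of p) = p.2).
Proof. by rewrite !inE. Qed.

Lemma set2_ofK :
  cancel (fun K : {set 'I_2} => (ord0 \in K, ord_max \in K)) set2_of.
Proof.
move=> K; apply/setP => k; rewrite inE /=.
by case: k => -[|[|//]] lt_k /=; congr (_ \in K); apply: val_inj.
Qed.

Lemma quat_sumE (c : {set 'I_2} -> R) :
  \sum_K c K *: quat_basis K =
  ((c (set2_of (false, false)) : R^o), (c (set2_of (false, true)) : R^o),
   (c (set2_of (true, false)) : R^o), - (c (set2_of (true, true)) : R^o)) :> T.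
Proof.
rewrite (reindex set2_of) /=; last first.
  exists (fun K : {set 'I_2} => (ord0 \in K, ord_max \in K)) => [p _|K _].
    by rewrite !in_set2_of; case: p.
  exact: set2_ofK.
rewrite (eq_bigr (fun p => c (set2_of (p.1, p.2)) *:
    ((if p.1 then quat_j else 1) * (if p.2 then quat_i else 1)))); last first.
  by move=> -[a b] _; rewrite /quat_basis !in_set2_of.
rewrite -(pair_big xpredT xpredT (fun a b => c (set2_of (a, b)) *:
    ((if a then quat_j else 1) * (if b then quat_i else 1)))) /=.
rewrite !big_bool /= !mulr1 !mul1r.
have -> : quat_j * quat_i = (0, 0, 0, -1) :> T.
  by congr (_, _, _, _); ring.
rewrite !quat_scaleE; congr (_, _, _, _) => /=; ring.
Qed.

Lemma quat_coordP (x : T) (c : {set 'I_2} -> R) :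
  x = \sum_K c K *: quat_basis K <-> forall K, c K = quat_coord K x.
Proof.
rewrite quat_sumE; split=> [-> K|cx].
  rewrite -{1}[K]set2_ofK /quat_coord /=.
  by case: (ord0 \in K); case: (ord_max \in K); rewrite ?opprK.
case: x cx => [[[a b] c'] d] cx.
by rewrite !cx /quat_coord !in_set2_of /= opprK.
Qed.

End Quaternions.

Definition quatAlg (R : realType) : starAlg R 2 :=
  @StarAlg R 2 (quat R) quat_conj quat_basis quat_coord quat_coordP.

Local Open Scope classical_set_scope.

Section Reconstructing.
Context {R : realType} {n : nat} (A : starAlg R n).

(* The set S_A. *)
Definition imag_unit (J : A) : Prop := sconj J = - J /\ J * J = -1.

(* The complex plane is R * R, with z = (alpha, beta) for alpha + i beta.
   circular D is Omega_D. *)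
Definition circular (D : set (R * R)) : set A :=
  [set x | exists z J, [/\ D z, imag_unit J & x = z.1%:A + z.2 *: J]].

(* circular D is a circular slice domain. *)
Definition circular_slice_domain (D : set (R * R)) : Prop :=
  [/\ D !=set0, open D, (forall z, D z -> D (z.1, - z.2)), connected D &
      exists t, D (t, 0)].

(* A * A is the complexification of A, with (x, y) for x + iota y. *)
Definition iota_mul (w : A * A) : A * A := (- w.2, w.1).

(* For F = F_1 + iota F_2, F_1 is even and F_2 is odd in beta. *)
Definition stem (D : set (R * R)) (F : R * R -> A * A) : Prop :=
  forall z, D z -> F (z.1, - z.2) = ((F z).1, - (F z).2).

Definition e_alpha : R * R := (1, 0).
Definition e_beta : R * R := (0, 1).

Definition C1_scalar (D : set (R * R)) (g : R * R -> R) : Prop :=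
  forall v z, v \in [:: e_alpha; e_beta] -> D z ->
    derivable g z v /\ {for z, continuous (fun w => 'D_v g w)}.

Definition C1 (D : set (R * R)) (F : R * R -> A * A) : Prop :=
  forall K, C1_scalar D (fun w => scoord K (F w).1) /\
            C1_scalar D (fun w => scoord K (F w).2).

(* The directional derivative, computed on the components of F. *)
Definition partial (v : R * R) (F : R * R -> A * A) (z : R * R) : A * A :=
  (\sum_K 'D_v (fun w => scoord K (F w).1) z *: sbasis A K,
   \sum_K 'D_v (fun w => scoord K (F w).2) z *: sbasis A K).

(* Only the values of f on circular D matter. *)
Definition slice_regular (D : set (R * R)) (f : A -> A) : Prop :=
  exists F : R * R -> A * A,
    [/\ stem D F,
        forall z J, D z -> imag_unit J ->
          f (z.1%:A + z.2 *: J) = (F z).1 + J * (F z).2,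
        C1 D F &
        forall z, D z -> partial e_alpha F z + iota_mul (partial e_beta F z) = 0].

Definition constant_on (T : Type) (X : set A) (g : A -> T) : Prop :=
  exists c, forall x, X x -> g x = c.

Definition reconstructing (KK : {set {set 'I_n}}) : Prop :=
  forall D, circular_slice_domain D -> forall f, slice_regular D f ->
    (forall K, K \in KK -> constant_on (circular D) (fun x => scoord K (f x))) ->
    constant_on (circular D) f.

Lemma reconstructing_exists : exists l,
  `[< exists KK : {set {set 'I_n}}, #|KK| = l /\ reconstructing KK >].
Proof.
exists #|[set: {set 'I_n}]%SET|; apply/asboolP; exists [set: {set 'I_n}]%SET.
split=> // D _ f _ fc.
have /choice[c cP] K : exists c, forall x, circular D x -> scoord K (f x) = c.
  by apply: fc; rewrite inE.
exists (\sum_K c K *: sbasis A K) => x Dx.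
by apply/scoordP => K; rewrite cP.
Qed.

Definition reconstructing_number : nat := ex_minn reconstructing_exists.

End Reconstructing.

(* Main.v *)
From HB Require Import structures.
Require Import Defs.
From mathcomp Require Import all_boot all_order all_algebra.
From mathcomp Require Import all_classical all_reals all_analysis.
From mathcomp Require Import zify ring lra.

(** The reconstructing number is a covering number of the hypercube of all
    index sets.

    Let f be induced by F = F_1 + iota F_2, and suppose that f_K is constant.
    Comparing f_K at z and at the conjugate of z, with the same J, separates
    the two terms of f(z) = F_1(z) + J F_2(z): the component (F_1)_K is
    constant, and (J F_2(z))_K = 0 for every imaginary unit J. The first fact
    and the Cauchy-Riemann equations make (F_2)_K constant, hence zero, as F_2
    vanishes at real points. In the second one, every basis element e_H with
    |H| = 1 or 2 mod 4 is an admissible J, and e_H permutes the basis up to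
    signs: so (F_2)_L = 0 whenever |K + L| = 1 or 2 mod 4, where + is the
    symmetric difference. Call L detected by K if L = K or |K + L| = 1, 2
    mod 4. If each L is detected by some K such that f_K is constant, then
    F_2 = 0, and the Cauchy-Riemann equations make F_1, hence f, constant
    (reconstructing_of_detection).
    If some L is detected by no K in the family, then f(x) = x e_L is a
    nonconstant slice regular function all of whose components in the family
    vanish, since an imaginary unit only has coordinates on the e_H with
    |H| = 1, 2 mod 4 (not_reconstructing_of_undetected). Together, for
    Clifford algebras, this is cliff_reconstructingP.

    It remains to count. For n = 2, and likewise for the quaternions, the empty
    set detects everything, since sizes do not exceed 2. One set K misses the
    sets at distance 3 from it, so that two sets are needed as soon as n >= 3.
    The empty set and the full set then suffice if n = 1 mod 4, because the
    distances l and n - l to them are never both 0 or 3 mod 4, and if n = 3, 4,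
    because l >= 3 forces n - l <= 1. Two sets K_1, K_2 at distance d never
    suffice if n >= 6 and n <> 1 mod 4: moving from K_1 by a elements of
    K_1 + K_2 and b elements outside of it leads to a set at distances a + b
    and d - a + b, and both can be made positive and 0 or 3 mod 4
    (undetected_by_pair). Finally the four subsets of a fixed pair always
    suffice (detected_by_quadruple). *)

Set Implicit Arguments.
Unset Strict Implicit.
Unset Printing Implicit Defensive.

Import Order.TTheory GRing.Theory Num.Theory.
Import numFieldNormedType.Exports.

Local Open Scope ring_scope.
Local Open Scope classical_set_scope.

(** * Partial derivatives on a plane domain *)

Section PlaneAnalysis.
Context {R : realType}.
Implicit Types (D : set (R * R)) (g : R * R -> R) (z v p : R * R).

Lemma is_derive_along g p v (t : R) :
  derivable g (p + t *: v) v ->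
  is_derive t 1 (fun s : R => g (p + s *: v)) ('D_v g (p + t *: v)).
Proof.
move=> dg.
have E : (fun h : R => h^-1 *: (((fun s : R => g (p + s *: v)) \o shift t)
             (h *: 1) - g (p + t *: v))) =
         (fun h : R => h^-1 *: ((g \o shift (p + t *: v)) (h *: v) -
             g (p + t *: v))).
  apply/funext => h /=.
  by rewrite scalerDl [h%:A]mulr1 addrCA.
by apply: DeriveDef; rewrite ?/derivable ?/derive E.
Qed.

Lemma eq_segment_derive0 g p v (a b : R) : a <= b ->
  (forall t, a <= t <= b ->
     derivable g (p + t *: v) v /\ 'D_v g (p + t *: v) = 0) ->
  g (p + a *: v) = g (p + b *: v).
Proof.
move=> ab dg; pose h (s : R) := g (p + s *: v).
have dh t : a <= t <= b -> is_derive t 1 h 0.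
  by move=> /dg[d <-]; exact: is_derive_along.
have [|t|t _] := @MVT_segment R h (cst 0) a b ab.
- by move=> t; rewrite in_itv /= => /andP[at_ tb]; apply: dh; rewrite !ltW.
- apply: derivable_within_continuous => s; rewrite in_itv /= => /dh ds.
  exact: ex_derive.
by rewrite mul0r => /eqP; rewrite subr_eq0 => /eqP.
Qed.

(** Two points of a square ball are joined by a horizontal and a vertical
    segment inside the ball, so that the mean value theorem on lines makes g
    locally constant, without asking for the differentiability of g. *)
Lemma constant_of_partials0 D g : open D -> connected D ->
  (forall v z, v \in [:: e_alpha; e_beta] -> D z ->
     derivable g z v /\ 'D_v g z = 0) ->
  forall z w, D z -> D w -> g z = g w.
Proof.
move=> oD cD dg.
have seg p v (a b : R) : v \in [:: e_alpha; e_beta] ->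
    (forall t, Num.min a b <= t <= Num.max a b -> D (p + t *: v)) ->
    g (p + a *: v) = g (p + b *: v).
  move=> ve; have [ab|/ltW ba] := leP a b => Dt.
    by apply: eq_segment_derive0 => // t /Dt; exact: dg.
  by apply/esym/eq_segment_derive0 => // t /Dt; exact: dg.
have eab (a b : R) : (a, b) = (0, b) + a *: e_alpha :> R * R.
  by rewrite /e_alpha; congr (_, _); rewrite /= /GRing.scale /=; ring.
have eba (a b : R) : (a, b) = (a, 0) + b *: e_beta :> R * R.
  by rewrite /e_beta; congr (_, _); rewrite /= /GRing.scale /=; ring.
have between (x y t e : R) : ball x e y ->
    Num.min x y <= t <= Num.max x y -> ball x e t.
  rewrite -ball_normE /= !ltr_norml => /andP[??].
  by rewrite ge_min le_max => /andP[/orP[?|?] /orP[?|?]]; apply/andP; split;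
    lra.
have loc x : D x ->
    exists2 e : R, 0 < e & ball x e `<=` [set y | D y /\ g y = g x].
  move=> Dx; have /nbhs_ballP[e e0 sD] := open_nbhs_nbhs (conj oD Dx).
  exists e => //= -[y1 y2]; case: x Dx sD => x1 x2 Dx sD xy.
  split; first exact: sD.
  case: xy => /= xy1 xy2; rewrite [in LHS]eba -(seg _ _ x2) -?eba.
  - rewrite [in LHS]eab -(seg _ _ x1) -?eab // => [|t tb].
      by rewrite !inE eqxx.
    rewrite -eab; apply: sD; split => /=; first exact: between tb.
    exact: ballxx.
  - by rewrite !inE eqxx orbT.
  by move=> t tb; rewrite -eba; apply: sD; split => //=; exact: between tb.
move=> z w Dz Dw.
(* Local constancy makes the preimage of any set of values open. *)
have opB (P : set R) : open [set x | D x /\ P (g x)].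
  rewrite openE => x /= [Dx Px]; apply/nbhs_ballP.
  have [e e0 sB] := loc _ Dx.
  by exists e => // y /sB [Dy gy] /=; rewrite gy.
suff /seteqP[_ /(_ _ Dw) []] : [set x | D x /\ g x = g z] = D by [].
apply: cD; first by exists z.
  exists [set x | D x /\ g x = g z]; first exact: (opB [set r | r = g z]).
  by rewrite setIidr // => x [].
exists (~` [set x | D x /\ g x <> g z]).
  exact/open_closedC/(opB [set r | r <> g z]).
apply/seteqP; split=> x /=; first by move=> [Dx gx]; split => // -[].
by move=> [Dx ngx]; split => //; apply: contrapT => gx; apply: ngx.
Qed.

(** The plane is the union of the lines through the origin. *)
Lemma plane_connected : connected [set: R * R].
Proof.
rewrite (_ : setT = \bigcup_(v in [set: R * R]) ((fun t : R => t *: v) @`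
  setT)).
  apply: bigcup_connected => [|v _].
    by exists 0 => v _; exists 0; rewrite ?scale0r.
  apply: connected_continuous_connected; first exact/connected_intervalP.
  by apply: continuous_subspaceT => t; exact: scalel_continuous.
by apply/seteqP; split=> // v _; exists v => //; exists 1; rewrite ?scale1r.
Qed.
End PlaneAnalysis.

(** * Detecting components of slice regular functions *)

Section StarAlg.
Context {R : realType} {n : nat} (A : starAlg R n).
Implicit Types (x y J : A) (K L : {set 'I_n}) (D : set (R * R)).

Lemma scoord_sum x : x = \sum_K scoord K x *: sbasis A K.
Proof. exact/scoordP. Qed.

Lemma scoord_is_linear K : linear (@scoord R n A K : A -> R^o).
Proof.
move=> a x y; apply/esym.
move: K; apply/scoordP; rewrite {1}[x]scoord_sum {1}[y]scoord_sum.
by rewrite scaler_sumr -big_split; apply: eq_bigr => K _;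
  rewrite scalerDl scalerA.
Qed.

HB.instance Definition _ K :=
  GRing.isLinear.Build R A R^o *:%R (@scoord R n A K) (scoord_is_linear K).

Lemma scoord_basis K L : scoord K (sbasis A L) = (K == L)%:R.
Proof.
apply/esym; move: K; apply/scoordP;
  rewrite (bigD1 L) //= eqxx scale1r big1 ?addr0 //.
by move=> K /negPf->; rewrite scale0r.
Qed.

Lemma scoord_inj x y : (forall K, scoord K x = scoord K y) -> x = y.
Proof.
by move=> xy; rewrite [x]scoord_sum; apply/esym/scoordP => K; rewrite xy.
Qed.

Lemma Cauchy_Riemann_coord (F : R * R -> A * A) z K :
  partial e_alpha F z + iota_mul (partial e_beta F z) = 0 ->
  'D_e_alpha (fun w => scoord K (F w).1) z =
    'D_e_beta (fun w => scoord K (F w).2) z /\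
  'D_e_alpha (fun w => scoord K (F w).2) z =
    - 'D_e_beta (fun w => scoord K (F w).1) z.
Proof.
have partialE v :
    (forall K, scoord K (partial v F z).1 =
       'D_v (fun w => scoord K (F w).1) z) /\
    (forall K, scoord K (partial v F z).2 =
       'D_v (fun w => scoord K (F w).2) z).
  by split=> H; apply/esym; move: H; apply/scoordP.
move=> CR; rewrite -!(partialE _).1 -!(partialE _).2.
move: CR (CR) => /(congr1 (fun w => scoord K w.1)) +
  /(congr1 (fun w => scoord K w.2)) /=.
rewrite !raddfD !raddfN raddf0 /= => /eqP; rewrite subr_eq0 => /eqP-> /eqP.
by rewrite addr_eq0 => /eqP->.
Qed.

Lemma derive_constant_on_open D (g : R * R -> R) (c : R) v z : open D ->
  (forall w, D w -> g w = c) -> D z -> 'D_v g z = 0.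
Proof.
move=> oD gc Dz; rewrite (@near_eq_derive _ _ _ _ (cst c)) ?derive_cst //.
by apply: filterS (open_nbhs_nbhs (conj oD Dz)) => w /gc.
Qed.

Lemma is_derive_linear (g : R * R -> R) z v : linear (g : R * R -> R^o) ->
  is_derive z v g (g v).
Proof.
move=> lg.
have cg : (fun h : R => h^-1 *: ((g \o shift z) (h *: v) - g z)) @ 0^' --> g v.
  apply: cvg_near_cst; near=> h => /=.
  rewrite lg addrK [h *: _]/GRing.scale /= [LHS]mulKf //.
  near: h; exact: nbhs_dnbhs_neq.
by apply: DeriveDef; [apply/cvg_ex; exists (g v)|exact/cvg_lim].
Unshelve. all: by end_near. Qed.

(** If f_K is constant then (J F_2)_K = 0, which the second alternative turns
    into (F_2)_L = 0. For L = K the same follows from the constancy of (F_1)_K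
    through the Cauchy-Riemann equations. *)
Lemma reconstructing_of_detection (KK : {set {set 'I_n}}) :
  (forall L, exists2 K, K \in KK & L = K \/
     exists J c, [/\ imag_unit J, c != 0 &
                     forall x, scoord K (J * x) = c * scoord L x]) ->
  reconstructing A KK.
Proof.
move=> detect D [_ oD symD cD [t Dt]] f [F [stemF fF C1F CR]] fc.
have [[J0 iJ0]|noJ] := pselect (exists J, @imag_unit _ _ A J); last first.
  by exists 0 => x [z [J [_ iJ _]]]; case: noJ; exists J.
have coord_eq0 (a : R) : a = - a -> a = 0 by lra.
have F2t : (F (t, 0)).2 = 0.
  have /= := stemF _ Dt; rewrite oppr0 => /(congr1 snd) /= Ft.
  apply: scoord_inj => K; rewrite raddf0; apply: coord_eq0.
  by rewrite -raddfN -Ft.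
(* The values of f at z and at the conjugate of z, along the same J, are
   F_1 + J F_2 and F_1 - J F_2. *)
have splitK K J z : K \in KK -> imag_unit J -> D z ->
    scoord K (F z).1 = scoord K (F (t, 0)).1 /\ scoord K (J * (F z).2) = 0.
  move=> /fc[c fKc] iJ Dz.
  have fc' w : D w -> scoord K (F w).1 + scoord K (J * (F w).2) = c.
    by move=> Dw; rewrite -raddfD -fF //; apply: fKc; exists w, J.
  have := fc' _ (symD _ Dz); rewrite stemF //= mulrN raddfN /=.
  have := fc' _ Dz; have := fc' _ Dt; rewrite F2t mulr0 raddf0.
  by move=> *; split; lra.
have dF L v z : v \in [:: e_alpha; e_beta] -> D z ->
    derivable (fun w => scoord L (F w).1) z v /\
    derivable (fun w => scoord L (F w).2) z v.
  move=> ve Dz; have [C1F1 C1F2] := C1F L.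
  by split; [have [] := C1F1 v z ve Dz|have [] := C1F2 v z ve Dz].
have CRL L z : D z -> _ := fun Dz => Cauchy_Riemann_coord L (CR z Dz).
have F2_0 L z : D z -> scoord L (F z).2 = 0.
  move=> Dz; have [K KKK [->|[J [c [iJ c0 cE]]]]] := detect L; last first.
    have [_ /eqP] := splitK _ _ _ KKK iJ Dz.
    by rewrite cE mulf_eq0 (negPf c0) => /eqP.
  rewrite -(raddf0 (scoord K)) -F2t.
  apply: (constant_of_partials0 (g := fun w => scoord K (F w).2) oD cD) => //.
  move=> v w ve Dw.
  have F1v u : 'D_u (fun w => scoord K (F w).1) w = 0.
    apply: (derive_constant_on_open (c := scoord K (F (t, 0)).1)) oD _ Dw.
    by move=> y /(splitK _ _ _ KKK iJ0)[].
  split; first by have [] := dF K v w ve Dw.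
  have [Ca Cb] := CRL K _ Dw; move: ve; rewrite !inE => /orP[]/eqP->.
    by rewrite Cb F1v oppr0.
  by rewrite -Ca F1v.
exists (F (t, 0)).1 => x [z [J [Dz iJ ->]]]; rewrite fF //.
apply: scoord_inj => L.
have -> : (F z).2 = 0 by apply: scoord_inj => K; rewrite F2_0 // raddf0.
rewrite mulr0 addr0.
apply: (constant_of_partials0 (g := fun w => scoord L (F w).1) oD cD) => //.
move=> v w ve Dw.
have F2v u : 'D_u (fun w => scoord L (F w).2) w = 0.
  by apply: (derive_constant_on_open (c := 0)) oD _ Dw => y; exact: F2_0.
split; first by have [] := dF L v w ve Dw.
have [Ca Cb] := CRL L _ Dw; move: ve; rewrite !inE => /orP[]/eqP->.
  by rewrite Ca F2v.
by apply/eqP; rewrite -oppr_eq0 -Cb F2v.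
Qed.

(** The witness is f(x) = x e_L on the whole of Q_A. The unit J0 makes Q_A
    nonempty. *)
Lemma not_reconstructing_of_undetected (KK : {set {set 'I_n}}) (J0 : A) L :
  imag_unit J0 ->
  (forall K, K \in KK -> K != L /\
     forall J : A, imag_unit J -> scoord K (J * sbasis A L) = 0) ->
  ~ reconstructing A KK.
Proof.
move=> iJ0 undet recKK.
pose e := sbasis A L.
have e1 : scoord L e = 1 by rewrite scoord_basis eqxx.
pose F (w : R * R) : A * A := (w.1 *: e, w.2 *: e).
have lin1 K : linear (fun w : R * R => scoord K (F w).1 : R^o).
  by move=> a u w; rewrite /= scalerDl -scalerA linearP.
have lin2 K : linear (fun w : R * R => scoord K (F w).2 : R^o).
  by move=> a u w; rewrite /= scalerDl -scalerA linearP.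
have dF1 K v z : 'D_v (fun w => scoord K (F w).1) z = scoord K (F v).1.
  by have [_] := is_derive_linear z v (lin1 K).
have dF2 K v z : 'D_v (fun w => scoord K (F w).2) z = scoord K (F v).2.
  by have [_] := is_derive_linear z v (lin2 K).
have C1lin (g : R * R -> R) : linear (g : _ -> R^o) -> C1_scalar setT g.
  move=> lg v z _ _; have [dg _] := is_derive_linear z v lg; split=> //.
  rewrite (_ : (fun w => 'D_v g w) = cst (g v)); first exact: cst_continuous.
  by apply/funext => w; have [] := is_derive_linear w v lg.
have regf : slice_regular setT (fun x : A => x * e).
  exists F; split=> [z _|z J _ _|K|z _].
  - by rewrite /F /= scaleNr.
  - by rewrite /= mulrDl mulr_algl -scalerAl scalerAr.
  - by split; exact: C1lin.
  rewrite /partial.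
  under eq_bigr do rewrite dF1.
  under [X in (_, X) + _]eq_bigr do rewrite dF2.
  under [X in iota_mul (X, _)]eq_bigr do rewrite dF1.
  under [X in iota_mul (_, X)]eq_bigr do rewrite dF2.
  rewrite -!scoord_sum /F /iota_mul /= scale0r scale1r.
  by congr (_, _); rewrite /= ?subrr ?addr0.
have domT : circular_slice_domain [set: R * R].
  split=> //; [by exists 0|exact: openT|exact: plane_connected|by exists 0].
have [|c fc] := recKK _ domT _ regf.
  move=> K /undet[KL JK]; exists 0 => x [z [J [_ iJ ->]]].
  rewrite mulrDl mulr_algl -scalerAl raddfD /= !linearZ /= JK //.
  by rewrite scoord_basis (negPf KL) !scaler0 addr0.
have f_at (a : R) : a *: e = c.
  rewrite -(fc (a%:A + 0 *: J0)); last by exists (a, 0), J0.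
  by rewrite scale0r addr0 mulr_algl.
have := f_at 1; rewrite -(f_at 0) scale0r scale1r => e0.
by move/eqP: e1; rewrite e0 raddf0 eq_sym oner_eq0.
Qed.

End StarAlg.

(** * Bounds from families of index sets *)

Section Number.
Context {R : realType} {n : nat} (A : starAlg R n).

Lemma reconstructing_number_le (KK : {set {set 'I_n}}) :
  reconstructing A KK -> (reconstructing_number A <= #|KK|)%N.
Proof.
move=> rKK; rewrite /reconstructing_number; case: ex_minnP => m _; apply.
by apply/asboolP; exists KK.
Qed.

Lemma reconstructing_number_gt k :
  (forall KK : {set {set 'I_n}}, (#|KK| <= k)%N -> ~ reconstructing A KK) ->
  (k < reconstructing_number A)%N.
Proof.
move=> notrec; rewrite /reconstructing_number;
  case: ex_minnP => m /asboolP[KK [<- rKK]] _.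
by rewrite ltnNge; apply/negP => /notrec; exact.
Qed.
End Number.

(** * Clifford algebras: detection is a matter of distance *)

Section CliffordCovering.
Context {R : realType} {n : nat}.
Implicit Types (K L H : {set 'I_n}).

(** These are the sizes of the H with e_H^c = - e_H, which are also those with
    e_H^2 = -1. *)
Definition imag_size (m : nat) := (m %% 4)%N \in [:: 1; 2]%N.

Lemma symdiffC K L : symdiff K L = symdiff L K.
Proof. by apply/setP => k; rewrite !inE addbC. Qed.

Lemma symdiff_eq0 K L : (symdiff K L == finset.set0) = (K == L).
Proof.
rewrite -(inj_eq (can_inj (symdiffK K))) symdiffK.
by rewrite [symdiff K finset.set0]symdiffC symdiff0 eq_sym.
Qed.

Lemma cliff_imag_unit_support (J : cliffAlg R n) H :
  imag_unit J -> ~~ imag_size #|H| -> J H = 0.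
Proof.
move=> [/ffunP/(_ H) JJ _]; rewrite /imag_size => HH.
suff : J H = - J H by lra.
move: JJ; rewrite /= !ffunE; case: ifP => // /negP[].
by move: HH (ltn_pmod #|H| (isT : 0 < 4)%N); case: (_ %% 4)%N => [|[|[|[|]]]].
Qed.

Lemma symdiffKr K L : symdiff (symdiff K L) L = K.
Proof. by rewrite symdiffC [symdiff K L]symdiffC symdiffK. Qed.

(** The pairs in K x K with p.2 <= p.1 and their mirror images cover K x K and
    overlap on the diagonal. *)
Lemma csign_diag K : csign (R := R) K K = (-1) ^+ 'C(#|K|.+1, 2).
Proof.
rewrite /csign; congr (_ ^+ _).
pose P := [set p : 'I_n * 'I_n |
  [&& p.1 \in K, p.2 \in K & (p.2 <= p.1)%N]]%SET.
pose sw (p : 'I_n * 'I_n) := (p.2, p.1).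
have swP : (sw @: P)%SET =
    [set p | [&& p.1 \in K, p.2 \in K & (p.1 <= p.2)%N]]%SET.
  apply/setP => -[a b]; rewrite inE /=;
    apply/imsetP/and3P => [[[c d]]|[aK bK ab]].
    by rewrite inE /= => /and3P[cK dK dc] [-> ->].
  by exists (b, a); rewrite // inE /= bK aK.
have cardsw : #|(sw @: P)%SET| = #|P|.
  by apply: card_imset => -[a b] [c d] [-> ->].
have UE : (P :|: sw @: P)%SET = finset.setX K K.
  rewrite swP; apply/setP => -[a b]; rewrite !inE /=.
  by case: (a \in K); case: (b \in K) => //=; exact: leq_total.
have IE : (P :&: sw @: P)%SET = ((fun a => (a, a)) @: K)%SET.
  rewrite swP; apply/setP => -[a b]; rewrite !inE /=; apply/idP/imsetP.
    move=> /andP[/and3P[aK bK ba] /and3P[_ _ ab]]; exists a => //.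
    by congr (_, _); apply/val_inj/eqP; rewrite eqn_leq ba.
  by move=> [c cK [-> ->]]; rewrite cK leqnn.
have cardI : #|((fun a => (a, a)) @: K)%SET| = #|K|.
  by apply: card_imset => a b [].
have := cardsUI P (sw @: P)%SET.
rewrite UE IE cardI cardsw cardsX => kk.
rewrite bin2 /= -[LHS](_ : #|P| = _); last by apply: eq_card => p; rewrite !inE.
by rewrite mulSn addnC kk addnn doubleK.
Qed.

(** The square is -1 because |H| (|H| + 1) / 2 is odd. *)
Lemma cliff_basis_imag_unit H :
  imag_size #|H| -> @imag_unit R n (cliffAlg R n) (cliff_basis H).
Proof.
move=> HH; split.
  apply/ffunP => K; rewrite /= !ffunE; have [->|_] := eqVneq K H; last first.
    by rewrite oppr0 if_same.
  by move: HH; rewrite /imag_size !inE => /orP[]/eqP->.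
rewrite [LHS]cliff_basis_mul csign_diag.
rewrite (_ : symdiff H H = finset.set0); last by apply/eqP; rewrite symdiff_eq0.
rewrite -signr_odd (_ : odd _) ?expr1 ?scaleN1r //; rewrite bin2 /=.
have [q mE] : exists q, #|H| = (4 * q + 1)%N \/ #|H| = (4 * q + 2)%N.
  exists (#|H| %/ 4)%N; move: HH; rewrite /imag_size !inE => /orP[]/eqP; lia.
rewrite (_ : _./2 = if (#|H| %% 2 == 1)%N then ((2 * q + 1) * (4 * q + 1))%N
                    else ((2 * q + 1) * (4 * q + 3))%N); last first.
  by case: mE => ->; case: ifP; nia.
by case: ifP => _; rewrite !(oddM, oddD).
Qed.

Lemma cliff_basis_mul_coord H L (x : cliff R n) :
  ((cliff_basis H : cliff R n) * x) L = csign H (symdiff H L) * x (symdiff H L).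
Proof.
rewrite [LHS]cliff_mulE (bigD1 H) //= big1 ?addr0.
  by rewrite ffunE eqxx mulr1.
by move=> M /negPf MH; rewrite ffunE MH mulr0 mul0r.
Qed.

Lemma cliff_mul_basis_coord K L (x : cliff R n) :
  (x * (cliff_basis K : cliff R n)) L = csign (symdiff K L) K * x (symdiff K L).
Proof.
rewrite [LHS]cliff_mulE (bigD1 (symdiff K L)) //= big1 ?addr0.
  by rewrite symdiffKr [X in _ * X]ffunE eqxx mulr1.
move=> M MKL; rewrite [cliff_basis K _]ffunE (_ : (_ == K) = false) ?mulr0 //.
by apply: contraNF MKL => /eqP <-; rewrite symdiffKr.
Qed.

Definition detects K L := (K == L) || imag_size #|symdiff K L|.

(** Up to sign, e_(K + L) times e_L is e_K, and no other basis element times e_L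
    has a coordinate on e_K. *)
Lemma cliff_reconstructingP (KK : {set {set 'I_n}}) : (0 < n)%N ->
  reconstructing (cliffAlg R n) KK <->
  forall L, exists2 K, K \in KK & detects K L.
Proof.
move=> n0; split=> [recKK L|detKK]; last first.
  apply: reconstructing_of_detection => L; have [K KKK] := detKK L.
  move=> /orP[/eqP <-|KL]; exists K => //; [by left|right].
  exists (cliff_basis (symdiff K L)), (csign (symdiff K L) L); split.
  - exact: cliff_basis_imag_unit.
  - by rewrite signr_eq0.
  move=> x; rewrite /= cliff_basis_mul_coord.
  by rewrite [symdiff (symdiff K L) K]symdiffC symdiffK.
have [//|undet] := pselect (exists2 K, K \in KK & detects K L).
have i0 := @cliff_basis_imag_unit [set Ordinal n0]%SET _.
case: (@not_reconstructing_of_undetected _ _ (cliffAlg R n) KK _ L (i0 _)) =>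
  //.
  by rewrite cards1.
move=> K KKK; have [KL|KL] := boolP (detects K L); first by case: undet;
  exists K.
move: KL; rewrite negb_or => /andP[KL sKL]; split=> // J iJ.
rewrite /= cliff_mul_basis_coord (cliff_imag_unit_support iJ) ?mulr0 //.
by rewrite symdiffC.
Qed.
End CliffordCovering.

(** * Covering the hypercube of index sets *)

Section Combinatorics.
Context {n : nat}.
Implicit Types (K L X : {set 'I_n}) (m : nat).

(** These are the distances at which one index set fails to detect another. *)
Definition hidden_size m := (0 < m)%N && ~~ imag_size m.

Lemma detectsE K L : detects K L = ~~ hidden_size #|symdiff K L|.
Proof. by rewrite /hidden_size lt0n cards_eq0 symdiff_eq0 negb_and !negbK. Qed.

Lemma hidden_sizeP m :
  reflect ((0 < m)%N /\ ((m %% 4)%N = 0%N \/ (m %% 4)%N = 3%N)) (hidden_size m).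
Proof.
rewrite /hidden_size /imag_size !inE; apply: (iffP andP) => -[m0 H];
  split=> //; lia.
Qed.

(** L is obtained from K1 by toggling a elements of K1 + K2 and b elements
    outside of K1 + K2. *)
Lemma undetected_of_profile K1 K2 a b :
  (a <= #|symdiff K1 K2|)%N -> (b <= n - #|symdiff K1 K2|)%N ->
  hidden_size (a + b) -> hidden_size (#|symdiff K1 K2| - a + b) ->
  exists L, ~~ detects K1 L /\ ~~ detects K2 L.
Proof.
set X := symdiff K1 K2 => aX bX hab hXab.
have subset_card (Y : {set 'I_n}) c : (c <= #|Y|)%N ->
    exists2 S : {set 'I_n}, S \subset Y & #|S| = c.
  move=> cY.
  have : (0 < #|[set S : {set 'I_n} | S \subset Y & #|S| == c]%SET|)%N.
    by rewrite cards_draws bin_gt0.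
  by case/card_gt0P => S; rewrite inE => /andP[SY /eqP]; exists S.
have [S SX cS] := subset_card X a aX.
have [|T TX cT] := subset_card (~: X)%SET b.
  by rewrite cardsCs finset.setCK card_ord.
have inX i : ((i \in S) ==> (i \in X)) && ((i \in T) ==> (i \notin X)).
  apply/andP; split; apply/implyP; first exact: (fintype.subsetP SX).
  by move=> /(fintype.subsetP TX); rewrite inE.
pose M := (S :|: T)%SET.
have cM : #|M| = (a + b)%N.
  rewrite cardsU cS cT (_ : S :&: T = finset.set0)%SET ?cards0 ?subn0 //.
  apply/setP => i; have := inX i; rewrite finset.in_setI finset.in_set0.
  by case: (i \in S); case: (i \in T); case: (i \in X).
have cXM : #|symdiff X M| = (#|X| - a + b)%N.
  rewrite (_ : symdiff X M = (X :\: S) :|: T)%SET; last first.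
    apply/setP => i; have := inX i.
    rewrite finset.in_setU finset.in_setD [i \in symdiff X M]inE finset.in_setU.
    by case: (i \in S); case: (i \in T); case: (i \in X).
  rewrite cardsU cardsD (finset.setIidPr SX) cS cT.
  rewrite (_ : _ :&: T = finset.set0)%SET ?cards0 ?subn0 //.
  apply/setP => i; have := inX i;
    rewrite finset.in_setI finset.in_setD finset.in_set0.
  by case: (i \in S); case: (i \in T); case: (i \in X).
exists (symdiff K1 M); rewrite !detectsE !negbK symdiffK cM; split=> //.
by rewrite symdiffA [symdiff K2 K1]symdiffC -/X cXM.
Qed.

(** The distances obtained are 3 or 4 to the first set when d >= 5, and d - 4,
    d - 3 or d - 1 to the second, according to d mod 4. For d = 1 mod 4 this
    needs a point outside, which exists because n <> 1 mod 4. For d < 5 both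
    distances are 3 or 4. *)
Lemma profile_of_distance d : (6 <= n)%N -> (n %% 4)%N != 1%N -> (d <= n)%N ->
  exists a b, [/\ (a <= d)%N, (b <= n - d)%N, hidden_size (a + b) &
                  hidden_size (d - a + b)].
Proof.
move=> n6 n1 dn.
have [d5|d5] := leqP 5 d.
  exists (if (d %% 4 == 0)%N then 4%N else
          if (d %% 4 == 1)%N then 2%N else 3%N).
  exists (if (d %% 4 == 1)%N then 1%N else 0%N).
  by case: ifP => ?; case: ifP => ?; split; try apply/hidden_sizeP; lia.
exists d./2, (if (d < 2)%N then 3%N else if (d < 4)%N then 2%N else 1%N).
by move: d5 {dn}; case: d => [|[|[|[|[|//]]]]] _ /=; split;
  try apply/hidden_sizeP; lia.
Qed.

Lemma undetected_by_pair K1 K2 : (6 <= n)%N -> (n %% 4)%N != 1%N ->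
  exists L, ~~ detects K1 L /\ ~~ detects K2 L.
Proof.
move=> n6 n1; have [|a [b [??]]] := @profile_of_distance #|symdiff K1 K2| n6 n1.
  by rewrite -[leqRHS]card_ord max_card.
exact: undetected_of_profile.
Qed.

Lemma undetected_by_one K : (3 <= n)%N -> exists L, ~~ detects K L.
Proof.
move=> n3; have KK : symdiff K K = finset.set0 by apply/eqP;
  rewrite symdiff_eq0.
have [||||L []] := @undetected_of_profile K K 0 3;
  rewrite ?KK ?cards0 ?subn0 //.
by exists L.
Qed.

Lemma card_symdiff_setT L : #|symdiff [set: 'I_n]%SET L| = (n - #|L|)%N.
Proof.
rewrite (_ : symdiff _ _ = ~: L)%SET;
  first by rewrite cardsCs finset.setCK card_ord.
by apply/setP => i; rewrite !inE.
Qed.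

Lemma card_symdiff_set1 i L :
  #|symdiff [set i]%SET L| = if i \in L then #|L|.-1 else #|L|.+1.
Proof.
case: ifPn => iL.
  rewrite (cardsD1 i L) iL /= (_ : symdiff _ _ = L :\ i)%SET //.
  by apply/setP => k; rewrite !inE; case: eqP => // ->; rewrite iL.
rewrite (_ : symdiff _ _ = i |: L)%SET ?cardsU1 ?iL //.
by apply/setP => k; rewrite !inE; case: eqP => // ->; rewrite (negPf iL).
Qed.

(** If |L| = 0 mod 4, one needs to add a point, or to remove two; if
    |L| = 3 mod 4, to remove a point, or to add two. Toggling i or j does the
    former, unless both are on the wrong side, and then toggling both does the
    latter. *)
Lemma detected_by_quadruple (i j : 'I_n) L : i != j ->
  exists2 K, K \in [set finset.set0; [set i]; [set j];
    symdiff [set i] [set j]]%SET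
    & detects K L.
Proof.
move=> ij.
suff [K] : exists K, K \in [:: finset.set0; [set i]; [set j];
  symdiff [set i] [set j]]%SET /\ detects K L.
  by case=> KK dK; exists K => //; move: KK; rewrite !inE -!orbA.
have cij : #|symdiff (symdiff [set i] [set j])%SET L| =
    if i \in L then if j \in L then #|L|.-2 else #|L|
    else if j \in L then #|L| else #|L|.+2.
  rewrite -symdiffA card_symdiff_set1 card_symdiff_set1 !inE (negPf ij).
  case iL: (i \in L); case jL: (j \in L) => //=.
  by apply: prednK; apply/card_gt0P; exists j.
have [/hidden_sizeP[L0 modL]|hL] := boolP (hidden_size #|L|); last first.
  by exists finset.set0; rewrite detectsE symdiff0 hL inE eqxx.
have [iL|iL] := eqVneq (i \in L) (#|L| %% 4 == 0)%N; last first.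
  exists [set i]%SET; split; first by rewrite !inE eqxx orbT.
  rewrite detectsE card_symdiff_set1; apply/hidden_sizeP.
  by case: (i \in L) iL => iL; lia.
have [jL|jL] := eqVneq (j \in L) (#|L| %% 4 == 0)%N; last first.
  exists [set j]%SET; split; first by rewrite !inE eqxx !orbT.
  rewrite detectsE card_symdiff_set1; apply/hidden_sizeP.
  by case: (j \in L) jL => jL; lia.
exists (symdiff [set i] [set j])%SET; split; first by rewrite !inE eqxx !orbT.
rewrite detectsE cij iL jL; apply/hidden_sizeP.
by case: eqP; lia.
Qed.
End Combinatorics.

(** * Values of the reconstructing numbers *)

Section Values.
Context {R : realType}.

Lemma nth_enum_of_card_le (T : finType) (x0 : T) (X : {set T}) k :
  (#|X| <= k)%N ->
  forall x, x \in X -> exists2 i, (i < k)%N & x = nth x0 (enum X) i.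
Proof.
move=> Xk x; rewrite -mem_enum => xX; exists (index x (enum X)).
  by rewrite (leq_trans _ Xk) // cardE index_mem.
by rewrite nth_index.
Qed.

Lemma cliff_number_gt1 n : (3 <= n)%N ->
  (1 < reconstructing_number (cliffAlg R n))%N.
Proof.
move=> n3; apply: reconstructing_number_gt => KK.
move=> /(nth_enum_of_card_le finset.set0) KKE.
have [L dL] := undetected_by_one (nth finset.set0 (enum KK) 0) n3.
move/cliff_reconstructingP => /(_ (leq_trans _ n3)) -/(_ isT)/(_ L)[K
  /KKE[[|//] _ ->]].
by apply/negP.
Qed.

Lemma cliff_number_gt2 n : (6 <= n)%N -> (n %% 4)%N != 1%N ->
  (2 < reconstructing_number (cliffAlg R n))%N.
Proof.
move=> n6 n1; apply: reconstructing_number_gt => KK.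
move=> /(nth_enum_of_card_le finset.set0) KKE.
have [L [d0 d1]] := undetected_by_pair (nth finset.set0 (enum KK) 0)
  (nth finset.set0 (enum KK) 1) n6 n1.
move/cliff_reconstructingP => /(_ (leq_trans _ n6)) -/(_ isT)/(_ L)[K
  /KKE[[|[|//]] _ ->]];
  exact/negP.
Qed.

(** A set of hidden size l <= n is at distance n - l from the full set, which
    is 1 or 2 mod 4 if n = 1 mod 4, and at most 1 if n is 3 or 4. *)
Lemma cliff_number_le2 n : [|| n == 3, n == 4 | n %% 4 == 1]%N ->
  (reconstructing_number (cliffAlg R n) <= 2)%N.
Proof.
move=> n_cases; pose KK := [set finset.set0; [set: 'I_n]]%SET.
have rKK : reconstructing (cliffAlg R n) KK.
  apply/cliff_reconstructingP => [|L]; first by case: n n_cases {KK}.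
  have Ln : (#|L| <= n)%N by rewrite -[leqRHS]card_ord max_card.
  have [dL|] := boolP (detects finset.set0 L).
    by exists finset.set0 => //; rewrite !inE eqxx.
  rewrite detectsE symdiff0 negbK => /hidden_sizeP hL.
  exists [set: 'I_n]%SET; first by rewrite !inE eqxx orbT.
  rewrite detectsE card_symdiff_setT; apply/hidden_sizeP; lia.
by apply: leq_trans (reconstructing_number_le rKK) _; rewrite cards2;
  case: (_ != _).
Qed.

Lemma cliff_number_le4 n : (2 <= n)%N ->
  (reconstructing_number (cliffAlg R n) <= 4)%N.
Proof.
case: n => [|[|n]] // _.
have ij : (ord0 : 'I_n.+2) != ord_max by [].
have rKK := (@cliff_reconstructingP R _ _ (ltn0Sn n.+1)).2
  (fun L => detected_by_quadruple L ij).
apply: leq_trans (reconstructing_number_le rKK) _.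
apply: leq_trans (leq_card_setU _ _) _; rewrite cards1 addn1 ltnS.
apply: leq_trans (leq_card_setU _ _) _; rewrite cards1 addn1 ltnS.
by apply: leq_trans (leq_card_setU _ _) _; rewrite !cards1.
Qed.

Lemma reconstructing_number_gt0 n (A : starAlg R n) (J : A) : imag_unit J ->
  (0 < reconstructing_number A)%N.
Proof.
move=> iJ; apply: reconstructing_number_gt => KK;
  rewrite leqn0 cards_eq0 => /eqP->.
by apply: (not_reconstructing_of_undetected (L := finset.set0) iJ) => K;
  rewrite inE.
Qed.

Lemma cliff_number2 : reconstructing_number (cliffAlg R 2) = 1%N.
Proof.
have i0 := @cliff_basis_imag_unit R 2 [set ord0]%SET.
apply/eqP; rewrite eqn_leq (reconstructing_number_gt0 (i0 _)) ?cards1 // andbT.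
have rKK : reconstructing (cliffAlg R 2) [set finset.set0]%SET.
  apply/cliff_reconstructingP => // L; exists finset.set0; first by rewrite inE.
  rewrite detectsE symdiff0; apply/hidden_sizeP.
  have : (#|L| <= 2)%N by rewrite -[leqRHS]card_ord max_card.
  lia.
by apply: leq_trans (reconstructing_number_le rKK) _; rewrite cards1.
Qed.

(** The empty set alone suffices: Re (q x) is, up to sign, the coordinate of x
    on q when q is i, j or k. *)
Lemma quat_number : reconstructing_number (quatAlg R) = 1%N.
Proof.
pose unit_q (b c d : R) : quatAlg R :=
  ((0 : R^o), (b : R^o), (c : R^o), (d : R^o)).
have unit_qP b c d : b * b + c * c + d * d = 1 -> imag_unit (unit_q b c d).
  move=> n1; split; first by congr (_, _, _, _); rewrite ?oppr0.
  rewrite [LHS]quat_mulE.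
  rewrite -[RHS]/((-1 : R^o), (-0 : R^o), (-0 : R^o), (-0 : R^o)).
  by rewrite -n1; congr (_, _, _, _); ring.
apply/eqP; rewrite eqn_leq (@reconstructing_number_gt0 _ _ (unit_q 1 0 0))
  ?andbT; last first.
  by apply: unit_qP; ring.
have rKK : reconstructing (quatAlg R) [set finset.set0]%SET.
  apply: reconstructing_of_detection => L; exists finset.set0;
    first by rewrite inE.
  rewrite -[L]set2_ofK; case: (ord0 \in L); case: (ord_max \in L).
  - right; exists (unit_q 0 0 1), 1; split; rewrite ?oner_eq0 //.
      by apply: unit_qP; ring.
    by move=> [[[a b] c] d]; rewrite /= /quat_coord !in_set2_of !inE /=; ring.
  - right; exists (unit_q 0 1 0), (-1); split; rewrite ?oppr_eq0 ?oner_eq0 //.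
      by apply: unit_qP; ring.
    by move=> [[[a b] c] d]; rewrite /= /quat_coord !in_set2_of !inE /=; ring.
  - right; exists (unit_q 1 0 0), (-1); split; rewrite ?oppr_eq0 ?oner_eq0 //.
      by apply: unit_qP; ring.
    by move=> [[[a b] c] d]; rewrite /= /quat_coord !in_set2_of !inE /=; ring.
  by left; apply/setP => k; rewrite !inE /= if_same.
by apply: leq_trans (reconstructing_number_le rKK) _; rewrite cards1.
Qed.
End Values.

Theorem theorem1p6 (R : realType) (n : nat) (hn : (2 <= n)%N) :
  [/\ reconstructing_number (cliffAlg R 2) = 1%N /\
      reconstructing_number (quatAlg R) = 1%N,
      reconstructing_number (cliffAlg R 3) = 2%N /\
      reconstructing_number (cliffAlg R 4) = 2%N,
      (n = 1 %[mod 4])%N -> reconstructing_number (cliffAlg R n) = 2%N &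
      (6 <= n)%N ->
      [\/ (n = 0 %[mod 4])%N, (n = 2 %[mod 4])%N | (n = 3 %[mod 4])%N] ->
      (3 <= reconstructing_number (cliffAlg R n) <= 4)%N].
Proof.
have eq2 m : (3 <= m)%N -> [|| m == 3, m == 4 | m %% 4 == 1]%N ->
    reconstructing_number (cliffAlg R m) = 2%N.
  by move=> m3 mc; apply/eqP;
    rewrite eqn_leq cliff_number_le2 // cliff_number_gt1.
split=> [||n1|n6 n023].
- by split; [exact: cliff_number2|exact: quat_number].
- by split; exact: eq2.
- by apply: eq2; rewrite ?n1 ?orbT //; lia.
rewrite cliff_number_gt2 ?cliff_number_le4 //.
by case: n023 => ->.
Qed.
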